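(* Let $\lambda=(\lambda_1,\dots,\lambda_M)\in\Lambda$. Then the queueing network representing the DAGs is rate stable under the scheduling policy defined by the update $p^{n+1}=[p^n+\beta^nU^{n+1}]_{\mathcal C_{\varepsilon_0}}$, $U^{n+1}_k=\mathbf 1_{E^n_k}\sum_{(i',i)\in\mathcal H_k}\Delta Q^{n+1}_{(i',i)}$; that is, $$\lim_{n\to\infty}\frac{Q^n_{(k',k)}}{n}=0\quad\text{almost surely, for every queue }(k',k)$$ (including the queues $(0,k)$ of root nodes $k$).
   Context: Network. There are $M$ job classes; class $m$ is a finite connected directed acyclic graph $\mathcal G_m=(\mathcal V_m,\mathcal E_m)$, the sets $\mathcal V_m$ being disjoint, with $\bigcup_m\mathcal V_m=\{1,\dots,K\}$ (nodes, i.e. task types) and $\mathcal E=\bigcup_m\mathcal E_m$. $m(k)$ is the class of node $k$; $\mathcal P_k=\{k':(k',k)\in\mathcal E\}$ is the set of parents of $k$; $k$ is a root if $\mathcal P_k=\emptyset$. There are $J$ servers; $\mathcal S_k\ne\emptyset$ is the set of servers able to serve node $k$, and $\mathcal T_j=\{k: j\in\mathcal S_k\}\neq\emptyset$. For $j\in\mathcal S_k$ the service rate is $\mu_{kj}=\mu_k\alpha_j$ with finite $\mu_k,\alpha_j>0$, and (after scaling time) $\sum_{j\in\mathcal S_k}\mu_{kj}<1$ for all $k$. Class-$m$ jobs have arrival rate $\lambda_m\in(0,1)$; $\nu_k:=\lambda_{m(k)}$. Capacity region. $\Lambda$ is the set of $\lambda\in\mathbb R_+^M$ for which there exist $p_{kj}\ge0$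 with $\sum_{k\in\mathcal T_j}p_{kj}\le1$ for all $j$ and $\nu_k\le\sum_{j\in\mathcal S_k}\mu_{kj}p_{kj}$ for all $k$. Queues and dynamics (discrete time $n=0,1,2,\dots$). There is one queue, with non-negative integer length $Q^n_{(k',k)}$, for each edge $(k',k)\in\mathcal E$, and one queue with length $Q^n_{(0,k)}$ for each root $k$; initial lengths are arbitrary and deterministic. $E^n_k$ is the event that a type-$k$ task is available: $E^n_k=\{Q^n_{(0,k)}>0\}$ if $k$ is a root, $E^n_k=\{Q^n_{(k',k)}>0\ \forall k'\in\mathcal P_k\}$ otherwise. Let $a^n_m\in\{0,1\}$ be the number of class-$m$ arrivals and $d^n_k\in\{0,1\}$ the number of type-$k$ tasks processed at time $n$. Then $Q^{n+1}_{(0,k)}=Q^n_{(0,k)}+a^n_{m(k)}-d^n_k$ for roots $k$, $Q^{n+1}_{(k',k)}=Q^n_{(k',k)}+d^n_{k'}-d^n_k$ for edges, and $\Delta Q^{n+1}_{(k',k)}=Q^{n+1}_{(k',k)}-Q^n_{(k',k)}$. Here $d^n_k=s^n_k\mathbf 1_{E^n_k}$, where, conditionally on the history up to time $n$ (all queue lengths and allocation vectors at times $\le n$), the variables $a^n_m$ ($1\le m\le M$) and $s^n_k$ ($1\le k\le K$) are independent Bernoulli with parameters $\lambda_m$ and $\mu_kp^n_k$ respectively. Policy. $p_k=\sum_{j\in\mathcal S_k}\alpha_jp_{kj}$ is the total capacity allocated to node $k$. $\mathcal C$ is the set of $p\in\mathbb R^K$ for which there exist $p_{kj}\ge0$ with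 $\sum_{j\in\mathcal S_k}\alpha_jp_{kj}=p_k$ for all $k$ and $\sum_{k\in\mathcal T_j}p_{kj}\le1$ for all $j$. Fix $\varepsilon_0>0$ with $\nu_k/\mu_k\ge\varepsilon_0$ for all $k$, and let $\mathcal C_{\varepsilon_0}=\{p\in\mathcal C: p_k\ge\varepsilon_0\ \forall k\}$; $[x]_{\mathcal C_{\varepsilon_0}}$ is the Euclidean projection of $x\in\mathbb{R}^K$ onto $\mathcal C_{\varepsilon_0}$. For each $k$, $\mathcal H_k$ is the set of queues on a fixed (arbitrarily chosen) path $(0,i_1),(i_1,i_2),\dots,(i_{L-1},i_L)$ with $i_1$ a root, $i_L=k$, and $(i_l,i_{l+1})\in\mathcal E$ (for $k$ a root, $\mathcal H_k=\{(0,k)\}$). $(\beta^n)$ is a positive decreasing sequence with $\sum_n\beta^n=\infty$, $\sum_n(\beta^n)^2<\infty$, and $\lim_{n\to\infty}\frac1{n\beta^n}$ existing and finite. The initial vector $p^0\in\mathcal C$ is arbitrary. *)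

(* Defs.v *)
From HB Require Import structures.
From mathcomp Require Import all_boot all_order all_algebra.
From mathcomp Require Import all_classical all_reals all_analysis.

Set Implicit Arguments.
Unset Strict Implicit.
Unset Printing Implicit Defensive.

Import Order.TTheory GRing.Theory Num.Theory.
Import numFieldNormedType.Exports.

Local Open Scope classical_set_scope.
Local Open Scope ring_scope.

(* The vertex set of the class-m DAG is the fibre of [cls] over m, so that the
   classes partition the nodes; [edge k' k] means that k' is a parent of k. *)
Record network (R : realType) (M K J : nat) := Network {
  cls : 'I_K -> 'I_M;
  edge : rel 'I_K;
  servers : 'I_K -> {set 'I_J};
  mu : 'I_K -> R;
  alpha : 'I_J -> R;
  cls_nonempty : forall m, exists k, cls k = m;
  edge_cls : forall k' k, edge k' k -> cls k' = cls k;
  edge_acyclic : forall c : seq 'I_K, cycle edge c -> c = [::];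
  cls_connected : forall k k', cls k = cls k' ->
    connect [rel x y | edge x y || edge y x] k k';
  servers_neq0 : forall k, servers k != finset.set0;
  tasks_neq0 : forall j, [set k | j \in servers k]%SET != finset.set0;
  mu_gt0 : forall k, 0 < mu k;
  alpha_gt0 : forall j, 0 < alpha j;
  rate_lt1 : forall k, \sum_(j in servers k) mu k * alpha j < 1 }.

Section Statics.
Context {R : realType} {M K J : nat}.
Implicit Types (N : network R M K J) (k : 'I_K) (p : 'I_K -> R).

Definition tasks N (j : 'I_J) : {set 'I_K} := [set k | j \in servers N k]%SET.

Definition capacity_region N : set ('I_M -> R) :=
  [set lam | (forall m, 0 <= lam m) /\
    exists x : 'I_K -> 'I_J -> R,
      [/\ forall k j, j \in servers N k -> 0 <= x k j,
          forall j, \sum_(k in tasks N j) x k j <= 1 &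
          forall k, lam (cls N k) <=
            \sum_(j in servers N k) mu N k * alpha N j * x k j]].

Definition allocations N : set ('I_K -> R) :=
  [set p | exists x : 'I_K -> 'I_J -> R,
      [/\ forall k j, j \in servers N k -> 0 <= x k j,
          forall k, \sum_(j in servers N k) alpha N j * x k j = p k &
          forall j, \sum_(k in tasks N j) x k j <= 1]].

Definition allocations_ge N (eps0 : R) : set ('I_K -> R) :=
  [set p | allocations N p /\ forall k, eps0 <= p k].

Definition l2dist (x y : 'I_K -> R) : R :=
  Num.sqrt (\sum_k (x k - y k) ^+ 2).

(* The nearest point of C to x; the default value x is only used when no
   nearest point exists (never the case for a nonempty closed convex C). *)
Definition euclid_proj (C : set ('I_K -> R)) (x : 'I_K -> R) : 'I_K -> R :=
  xget x [set y | C y /\ forall z, C z -> l2dist x y <= l2dist x z].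

Definition is_root N k : bool := [forall k', ~~ edge N k' k].

(* The pair (None, k) stands for the queue (0, k) of a root k, and
   (Some k', k) for the queue of the edge (k', k). *)
Definition is_queue N (q : option 'I_K * 'I_K) : bool :=
  if q.1 is Some k' then edge N k' q.2 else is_root N q.2.

Definition queue N : finType := {q : option 'I_K * 'I_K | is_queue N q}.

Definition src N (q : queue N) : option 'I_K := (sval q).1.
Definition tgt N (q : queue N) : 'I_K := (sval q).2.

(* The queues into k are (0, k) alone if k is a root, and the (k', k) with k'
   a parent of k otherwise. *)
Definition available N (Q : queue N -> nat) k : bool :=
  [forall q : queue N, (tgt q == k) ==> (0 < Q q)%N].

Definition root_path N k (s : seq 'I_K) : bool :=
  if s is i1 :: t then [&& is_root N i1, path (edge N) i1 t & last i1 t == k]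
  else false.

(* For s = [:: i_1; ...; i_L]: the queues (0,i_1), (i_1,i_2), ...,
   (i_(L-1),i_L). *)
Definition path_queues N (s : seq 'I_K) : {set queue N} :=
  [set q : queue N | sval q \in zip (None :: map Some s) s]%SET.

End Statics.

Section Dynamics.
Context {R : realType} {M K J : nat} {d : measure_display}
  {T : measurableType d} (P : probability T R) (N : network R M K J).

Definition completed (s : nat -> 'I_K -> T -> bool)
    (Q : nat -> queue N -> T -> nat) (n : nat) (k : 'I_K) (w : T) : bool :=
  s n k w && available (fun q => Q n q w) k.

Definition inflow (a : nat -> 'I_M -> T -> bool) (s : nat -> 'I_K -> T -> bool)
    (Q : nat -> queue N -> T -> nat) (n : nat) (q : queue N) (w : T) : bool :=
  if src q is Some k' then completed s Q n k' w else a n (cls N (tgt q)) w.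

(* [policy_update hpath Q n] is the update direction U^(n+1). *)
Definition policy_update (hpath : 'I_K -> seq 'I_K)
    (Q : nat -> queue N -> T -> nat) (n : nat) (k : 'I_K) (w : T) : R :=
  (available (fun q => Q n q w) k)%:R *
  \sum_(q in path_queues N (hpath k)) ((Q n.+1 q w)%:R - (Q n q w)%:R).

Definition history (Q : nat -> queue N -> T -> nat) (p : nat -> 'I_K -> T -> R)
    (n : nat) : set_system T :=
  <<s [set A | exists2 i, (i <= n)%N &
        (exists q (B : set nat), A = Q i q @^-1` B) \/
        (exists k (B : set R), measurable B /\ A = p i k @^-1` B)] >>.

(* f is a version of the conditional probability of B given the
   sigma-algebra G. *)
Definition is_cond_prob (G : set_system T) (B : set T) (f : T -> R) : Prop :=
  (forall Y : set R, measurable Y -> G (f @^-1` Y)) /\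
  (forall A, G A -> P (A `&` B) = (\int[P]_(w in A) (f w)%:E)%E).

(* Given G, the X_i are mutually independent and X_i is Bernoulli with the
   (random) parameter r_i: product rule over every subfamily D. *)
Definition cond_indep_bernoulli (I : finType) (G : set_system T)
    (X : I -> T -> bool) (r : I -> T -> R) : Prop :=
  forall (D : {set I}) (b : I -> bool),
    is_cond_prob G [set w | forall i, i \in D -> X i w = b i]
      (fun w => \prod_(i in D) bernoulli_pmf (r i w) (b i)).

End Dynamics.

(* Main.v *)
Require Import Defs.
From HB Require Import structures.
From mathcomp Require Import all_boot all_order all_algebra.
From mathcomp Require Import all_classical all_reals all_analysis.
From mathcomp Require Import measurable_realfun ring lra zify.

Set Implicit Arguments.
Unset Strict Implicit.
Unset Printing Implicit Defensive.

Import Order.TTheory GRing.Theory Num.Theory.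
Import numFieldNormedType.Exports.

Local Open Scope classical_set_scope.
Local Open Scope ring_scope.

(** Let [W_k n] be the number of class-[cls k] arrivals minus the number of
type-[k] completions before time [n]. Each queue [(k', k)] equals its initial
length plus [W_k - W_k'], and the sum of the queues along a path to [k]
telescopes to [W_k] up to a constant. Hence [U_k] is the increment of [W_k] on
the event [E_k], with conditional mean [- 1_(E_k) mu_k (p_k - nu_k / mu_k)]; as
the point [nu / mu] lies in the convex set onto which one projects, the
expected squared distance of [p n] to it decreases at each step by
[2 beta_n sum_k mu_k E (1_(E_k) (p_k - nu_k / mu_k)^2)], up to the summable
[K beta_n^2]. Since [beta_n >= c / n], Kronecker's lemma makes the averages of
[1_(E_k) |p_k - nu_k / mu_k|] vanish almost surely. Together with a strong law
for the increments of [W_k], this says that [W_k n] is [nu_k] times the number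
of times before [n] at which [E_k] fails, up to [o(n)]. At such a time some
queue into [k] is empty, so that [W_k] equals [W_k'] up to a constant for some
parent [k'] (or [0] for a root); induction on the acyclic graph then gives
[W_k n = o(n)] for all [k]. *)

(** * Sequences of smaller order than n *)

(** This is [f n = o(n)]. The constant absorbs finitely many terms, so that the bound holds at every
    [n] and survives bounded perturbations. *)
Definition sublinear (R : realType) (f : nat -> R) : Prop :=
  forall e, 0 < e -> exists C, forall n, `|f n| <= e * n%:R + C.

Lemma sublinear0 (R : realType) : sublinear (fun=> 0 : R).
Proof.
by move=> e e0; exists 0 => n; rewrite normr0 addr0 mulr_ge0// ltW.
Qed.

Lemma sublinear_le (R : realType) (f g : nat -> R) (C : R) :
  (forall n, `|f n| <= `|g n| + C) -> sublinear g -> sublinear f.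
Proof.
move=> fg gs e /gs [D gD]; exists (D + C) => n.
by rewrite (le_trans (fg n))// addrA lerD2r.
Qed.

Lemma sublinear_norm (R : realType) (f : nat -> R) :
  sublinear f -> sublinear (fun n => `|f n|).
Proof. by apply: (@sublinear_le _ _ _ 0) => n; rewrite normr_id addr0. Qed.

Lemma sublinearD (R : realType) (f g : nat -> R) :
  sublinear f -> sublinear g -> sublinear (fun n => f n + g n).
Proof.
move=> fs gs e e0; have e20 : 0 < e / 2 by rewrite divr_gt0.
have [C fC] := fs _ e20; have [D gD] := gs _ e20; exists (C + D) => n.
have := fC n; have := gD n; have := ler_normD (f n) (g n); lra.
Qed.

Lemma sublinearZ (R : realType) (c : R) (f : nat -> R) :
  sublinear f -> sublinear (fun n => c * f n).
Proof.
move=> fs e e0; have c0 : 0 < `|c| + 1 by rewrite ltr_wpDl.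
have [C fC] := fs (e / (`|c| + 1)) (divr_gt0 e0 c0).
exists ((`|c| + 1) * C) => n; rewrite normrM.
apply: (@le_trans _ _ ((`|c| + 1) * `|f n|)).
  by rewrite ler_wpM2r// lerDl.
rewrite (le_trans (ler_wpM2l (ltW c0) (fC n)))// mulrDr mulrA.
by rewrite [_ * (e / _)]mulrC divfK ?gt_eqF.
Qed.

Lemma sublinear_sum (R : realType) (I : Type) (r : seq I) (Pr : pred I)
    (f : I -> nat -> R) :
  (forall i, Pr i -> sublinear (f i)) ->
  sublinear (fun n => \sum_(i <- r | Pr i) f i n).
Proof.
move=> fs; elim: r => [|i r IH].
  rewrite (_ : (fun n => _) = (fun=> 0)); first exact: sublinear0.
  by apply/funext => n; rewrite big_nil.
have [Pi|nPi] := boolP (Pr i).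
  rewrite (_ : (fun n => _) = (fun n => f i n + \sum_(j <- r | Pr j) f j n)).
    by apply: sublinearD => //; exact: fs.
  by apply/funext => n; rewrite big_cons Pi.
rewrite (_ : (fun n => _) = (fun n => \sum_(j <- r | Pr j) f j n))//.
by apply/funext => n; rewrite big_cons (negbTE nPi).
Qed.

Lemma sublinear_cvg (R : realType) (f : nat -> R) :
  sublinear f -> (fun n => f n / n%:R) @ \oo --> (0 : R).
Proof.
move=> fs; apply/cvgrPdist_le => e e0; have e20 : 0 < e / 2 by rewrite divr_gt0.
have [C fC] := fs _ e20; near=> n.
have n0 : 0 < n%:R :> R by rewrite ltr0n; near: n; exact: nbhs_infty_gt.
rewrite sub0r normrN normrM normfV (ger0_norm (ltW n0)) ler_pdivrMr//.
have : C <= e / 2 * n%:R.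
  rewrite mulrC -ler_pdivrMr//; near: n; exact: nbhs_infty_ger.
have := fC n; lra.
Unshelve. all: by end_near. Qed.

(* The contribution of the first terms goes into the constant, and each later
   x i is at most n * (x i / i.+1). *)
Lemma sublinear_kronecker (R : realType) (x : nat -> R) :
  (forall n, 0 <= x n) -> cvgn (series (fun n => x n / n.+1%:R)) ->
  sublinear (series x).
Proof.
move=> x0; set u := fun n => _ => cu e e0.
have u0 n : 0 <= u n by rewrite divr_ge0.
have ndx : nondecreasing_seq (series x).
  by apply: nondecreasing_series => n _ _.
have ndu : nondecreasing_seq (series u).
  by apply: nondecreasing_series => n _ _.
have leL := nondecreasing_cvgn_le ndu cu.
have [n0 _ n0P] : \forall n \near \oo, limn (series u) - e < series u n.
  apply: (cvgr_gt (limn (series u))) => //.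
  by rewrite ltrBlDr ltrDl.
exists (series x n0) => n; rewrite ger0_norm; last first.
  by rewrite /series/= sumr_ge0.
have [nn0|n0n] := leqP n n0.
  by rewrite (le_trans (ndx _ _ nn0))// lerDr mulr_ge0// ltW.
have n0n' := ltnW n0n.
rewrite -lerBlDr sub_series_geq//.
have : series u n - series u n0 <= e.
  by have := leL n; have /= := n0P n0 (leqnn _); lra.
rewrite sub_series_geq// => h.
rewrite (le_trans _ (ler_wpM2r (ler0n _ n) h))//.
rewrite mulr_suml big_nat_cond [leRHS]big_nat_cond; apply: ler_sum => i.
rewrite andbT => /andP[_ ni]; rewrite /u mulrAC ler_pdivlMr// ler_wpM2l//.
by rewrite ler_nat.
Qed.

(** Summing [2 * e * |x| <= x ^+ 2 + e ^+ 2] over the first [n] terms turns a small average of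
    squares into a small average of absolute values. *)
Lemma sublinear_series_norm (R : realType) (x : nat -> R) :
  sublinear (series (fun n => x n ^+ 2)) ->
  sublinear (series (fun n => `|x n|)).
Proof.
move=> xs e e0; have [C xC] := xs (e ^+ 2) (exprn_gt0 _ e0).
exists (C / (2 * e)) => n; rewrite ger0_norm ?sumr_ge0//.
have /= := xC n; rewrite ger0_norm; last by rewrite sumr_ge0// => i _; exact: sqr_ge0.
have : 2 * e * series (fun n => `|x n|) n <=
    series (fun n => x n ^+ 2) n + e ^+ 2 * n%:R.
  have -> : e ^+ 2 * n%:R = \sum_(0 <= i < n) e ^+ 2.
    by rewrite sumr_const_nat subn0 mulr_natr.
  rewrite /series/= mulr_sumr -big_split/=.
  apply: ler_sum => i _; rewrite -(real_normK (num_real (x i))).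
  by have := sqr_ge0 (`|x i| - e); rewrite sqrrB; lra.
move=> h1 h2.
rewrite -(ler_pM2l (_ : 0 < 2 * e)) ?mulr_gt0//.
have -> : 2 * e * (e * n%:R + C / (2 * e)) = 2 * (e ^+ 2 * n%:R) + C.
  by field; rewrite gt_eqF.
lra.
Qed.

(** * Induction on the acyclic graph and the pathwise workload bound *)

(** Induction on the number of ancestors of [k], itself included: it drops strictly from [k] to a
    parent, since by acyclicity [k] is not an ancestor of its parent. *)
Lemma graph_ind (R : realType) (M K J : nat) (N : network R M K J)
    (A : 'I_K -> Prop) :
  (forall k, (forall k', edge N k' k -> A k') -> A k) -> forall k, A k.
Proof.
move=> IH k; pose anc k := [set x | connect (edge N) x k]%SET.
have [n] := ubnP #|anc k|; elim: n k => // n IHn k kn.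
apply: IH => k' k'k; apply: IHn; rewrite -ltnS; apply: leq_trans kn.
rewrite ltnS; apply: proper_card; apply/properP; split.
  apply/fintype.subsetP => x; rewrite !inE => xk'.
  exact: connect_trans xk' (connect1 k'k).
exists k; rewrite !inE ?connect0//; apply/negP => /connectP[c kc lc].
have /= := @edge_acyclic _ _ _ _ N (k :: c); rewrite rcons_path kc -lc k'k.
by move=> /(_ isT).
Qed.

(** The outside source of a root queue counts as a node of value 0, so that one formula covers root
    queues and edge queues. *)
Definition src_val (R : realType) (M K J : nat) (N : network R M K J)
  (F : 'I_K -> R) (q : queue N) : R := if src q is Some k' then F k' else 0.

Lemma exists_queue (R : realType) (M K J : nat) (N : network R M K J) k :
  exists q : queue N, tgt q = k.
Proof.
have [rk|] := boolP (is_root N k).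
  by exists (exist _ (None, k) rk).
rewrite negb_forall => /existsP[k' /negPn k'k].
by exists (exist _ (Some k', k) k'k).
Qed.

Lemma sublinear_workload (R : realType) (M K J : nat) (N : network R M K J)
    (nu : 'I_K -> R) (W : nat -> 'I_K -> R) (Q : nat -> queue N -> nat) :
  (forall k, 0 <= nu k) ->
  (forall n q, (Q n q)%:R = (Q 0 q)%:R + W n (tgt q) - src_val (W n) q) ->
  (forall k, sublinear (fun n =>
     W n k - nu k * \sum_(0 <= i < n) (~~ available (Q i) k)%:R)) ->
  forall k, sublinear (W ^~ k).
Proof.
move=> nu0 QE drift; apply: graph_ind => k IH e e0.
have e50 : 0 < e / 5 by rewrite divr_gt0.
pose G n : R := \sum_(q : queue N | tgt q == k) `|src_val (W n) q|.
have Gs : sublinear G.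
  apply: sublinear_sum => q /eqP qk; apply: sublinear_norm; rewrite /src_val.
  case: q qk => -[[k'|] l] lP; rewrite /tgt /src/= => lk; last exact: sublinear0.
  by apply: IH; rewrite -lk; exact: lP.
have {Gs}[C GC] := Gs _ e50; have [D rD] := drift k _ e50.
have srcle n (q : queue N) : tgt q = k -> `|src_val (W n) q| <= e / 5 * n%:R + C.
  move=> /eqP qk; apply: le_trans (le_trans (ler_norm _) (GC n)).
  by rewrite /G/= (bigD1 q)//= lerDl sumr_ge0.
pose c n : R := \sum_(0 <= i < n) (~~ available (Q i) k)%:R.
have c0 n : 0 <= c n by rewrite sumr_ge0.
(* The horizon [m] is fixed so that the bound does not move during the induction on [n]. If [k] is
   available the count stays; otherwise an empty queue bounds [nu k * c n] directly, and the final
   [nu k] pays for the new unit. *)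
have count_le m n : (n <= m)%N ->
    nu k * c n <= 2 * (e / 5 * m%:R) + `|C| + `|D| + nu k.
  elim: n => [_|n IHn nm].
    by rewrite /c big_nil mulr0 !addr_ge0// !mulr_ge0// ltW.
  rewrite /c big_nat_recr//= -/(c n).
  have [av|nav] := boolP (available (Q n) k); first by rewrite addr0 IHn// ltnW.
  rewrite mulrDr mulr1 lerD2r.
  move: nav; rewrite negb_forall => /existsP[q].
  rewrite negb_imply -eqn0Ngt => /andP[/eqP qk /eqP Qn0].
  have := QE n q; rewrite Qn0 qk => QEn.
  have : e / 5 * n%:R <= e / 5 * m%:R by rewrite ler_wpM2l ?(ltW e50)// ler_nat ltnW.
  have := ler_norm (src_val (W n) q); have := srcle n q qk.
  have := rD n; rewrite -/(c n) ler_norml => /andP[+ _].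
  have := ler_norm C; have := ler_norm D; have := ler0n R (Q 0 q); lra.
have [q qk] := exists_queue N k.
exists (`|C| + 2 * `|D| + nu k + (Q 0 q)%:R) => n; rewrite ler_norml; apply/andP.
have en0 : 0 <= e * n%:R by rewrite mulr_ge0// ltW.
have := nu0 k; have := ler_norm C; have := normr_ge0 D.
have := ler_norm D; split.
  have := QE n q; have := srcle n q qk; rewrite qk ler_norml => /andP[+ _].
  have := ler0n R (Q n q); have := normr_ge0 C; lra.
have := count_le n n (leqnn _).
have := rD n; rewrite -/(c n) ler_norml => /andP[_].
have := ler0n R (Q 0 q); lra.
Qed.

(** * The set of allocations and the Euclidean projection *)

Lemma continuous_sumr (R : realType) (T : topologicalType) (I : Type)
    (r : seq I) (Pr : pred I) (f : I -> T -> R) :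
  (forall i, continuous (f i)) ->
  continuous (fun x => \sum_(i <- r | Pr i) f i x).
Proof.
move=> fc x; apply: cvg_big => [|i _]; last exact: fc.
exact: add_continuous.
Qed.

(** Each share [x k j] is at most 1 by the constraint of server [j], so [mu N k * p k] is at most
    the total rate available to [k]: it is a legitimate Bernoulli parameter. *)
Lemma allocations_bound (R : realType) (M K J : nat) (N : network R M K J) p k :
  allocations N p -> 0 <= p k /\ mu N k * p k <= 1.
Proof.
move=> [x [x0 xp x1]]; rewrite -xp; split.
  by apply: sumr_ge0 => j jk; rewrite mulr_ge0 ?x0// ltW ?alpha_gt0.
rewrite mulr_sumr (le_trans _ (ltW (rate_lt1 N k)))//; apply: ler_sum => j jk.
rewrite mulrA ler_piMr ?mulr_ge0 ?(ltW (mu_gt0 _ _)) ?(ltW (alpha_gt0 _ _))//.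
apply: le_trans (x1 j); have kj : k \in tasks N j by rewrite finset.inE.
by rewrite (bigD1 k)//= lerDl sumr_ge0// => i; rewrite finset.inE => /andP[? _]; exact: x0.
Qed.

(** The capacity region only gives [lam (cls N k) <= c k], while an allocation of exactly
    [lam (cls N k) / mu N k] is wanted. Scaling the shares of [k] by [lam (cls N k) / c k], at most
    1, gives equality and respects the servers. *)
Lemma allocations_target (R : realType) (M K J : nat) (N : network R M K J)
    lam eps0 :
  capacity_region N lam -> (forall k, eps0 <= lam (cls N k) / mu N k) ->
  allocations_ge N eps0 (fun k => lam (cls N k) / mu N k).
Proof.
move=> [lam0 [x [x0 x1 lamx]]] elam; split => //.
pose c k : R := \sum_(j in servers N k) mu N k * alpha N j * x k j.
have c0 k : 0 <= c k.
  apply: sumr_ge0 => j jk; rewrite !mulr_ge0 ?x0//.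
    exact: ltW (mu_gt0 _ _).
  exact: ltW (alpha_gt0 _ _).
have rc k : 0 <= lam (cls N k) / c k <= 1.
  rewrite divr_ge0//=; have [->|ck] := eqVneq (c k) 0; first by rewrite invr0 mulr0.
  by rewrite ler_pdivrMr ?mul1r ?lamx// lt0r ck c0.
exists (fun k j => lam (cls N k) / c k * x k j); split => [k j jk|k|j].
- by have /andP[? _] := rc k; rewrite mulr_ge0// x0.
- have muk := mu_gt0 N k.
  transitivity (lam (cls N k) / c k * (c k / mu N k)).
    rewrite [in c k / _]/c mulr_suml mulr_sumr; apply: eq_bigr => j _.
    by set g := lam _ / c k; field; rewrite gt_eqF.
  (* If [c k] is 0 the quotient is 0 by convention, and the capacity bound forces the arrival rate
     to be 0 as well. *)
  have [ck|ck] := eqVneq (c k) 0; last by rewrite mulrA divfK.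
  have := lamx k; rewrite -/(c k) ck => lk.
  have -> : lam (cls N k) = 0 by apply/eqP; rewrite eq_le lk lam0.
  by rewrite !mul0r.
- apply: le_trans (x1 j); apply: ler_sum => k; rewrite finset.inE => kj.
  by have /andP[_ ?] := rc k; rewrite ler_piMl// x0.
Qed.

Lemma allocations_ge_convex (R : realType) (M K J : nat) (N : network R M K J)
    eps0 p r t :
  allocations_ge N eps0 p -> allocations_ge N eps0 r -> 0 <= t <= 1 ->
  allocations_ge N eps0 (fun k => p k + t * (r k - p k)).
Proof.
move=> [[x [x0 xp x1]] pe] [[y [y0 yr y1]] re] /andP[t0 t1]; split; last first.
  move=> k; have := pe k; have := re k.
  have : 0 <= 1 - t by rewrite subr_ge0.
  nra.
have t1' : 0 <= 1 - t by rewrite subr_ge0.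
exists (fun k j => (1 - t) * x k j + t * y k j); split => [k j jk|k|j].
- by rewrite addr_ge0// mulr_ge0 ?x0 ?y0.
- rewrite -xp -yr -sumrB mulr_sumr -big_split/=.
  by apply: eq_bigr => j _; ring.
- rewrite big_split/= -!mulr_sumr.
  by have := x1 j; have := y1 j; nra.
Qed.

(** The constraint set is the image, under the continuous map [p], of a compact set of share
    matrices with entries in the unit interval, on which the squared distance to [z] attains its
    minimum. *)
Lemma allocations_ge_nearest (R : realType) (M K J : nat) (N : network R M K J)
    eps0 (z : 'I_K -> R) :
  allocations_ge N eps0 !=set0 ->
  exists2 y, allocations_ge N eps0 y &
    forall r, allocations_ge N eps0 r -> l2dist z y <= l2dist z r.
Proof.
move=> C0.
pose X := prod_topology (fun _ : 'I_K * 'I_J => R).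
pose p (x : X) k : R := \sum_(j in servers N k) alpha N j * x (k, j).
pose S : set X := [set x | forall i, `[0, 1]%classic (x i)] `&`
  ((\bigcap_j [set x | \sum_(k in tasks N j) x (k, j) <= 1]) `&`
   (\bigcap_k [set x | eps0 <= p x k])).
have xc i : continuous (fun x : X => x i).
  exact: (@proj_continuous _ (fun=> R) i).
have pc k : continuous (fun x : X => p x k).
  apply: (@continuous_sumr _ X _ _ _ (fun j x => alpha N j * x (k, j))) => j x.
  apply: (@continuous_comp _ _ _ (fun x : X => x (k, j)) ( *%R (alpha N j))).
    exact: xc.
  exact: mulrl_continuous.
have Sc : compact S.
  apply: compact_closedI.
    apply: (@tychonoff _ (fun=> R) (fun=> `[0, 1]%classic)) => _.
    exact: segment_compact.
  apply: closedI; apply: closed_bigI => i _.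
    apply: (@preimage_closed _ _ (fun x : X => \sum_(k in tasks N i) x (k, i))
      [set y | y <= 1]); last exact: closed_le.
    move=> x _; apply: (@continuous_sumr _ X _ _ _ (fun k x => x (k, i))) => k.
    exact: xc.
  apply: (@preimage_closed _ _ (p ^~ i) [set y | eps0 <= y]); last exact: closed_ge.
  by move=> x _; exact: pc.
have SP x : S x -> allocations_ge N eps0 (p x).
  move=> [x01 [x1 xe]]; split; last by move=> k; exact: xe.
  exists (fun k j => x (k, j)); split => // [k j _|j]; last exact: x1.
  by have /= := x01 (k, j); rewrite in_itv/= => /andP[].
have PS r : allocations_ge N eps0 r -> exists2 x, S x & p x = r.
  move=> [[x [x0 xr x1]] re].
  (* Shares of servers unable to serve the node are unconstrained in [allocations]; setting them to
     0 puts the matrix in the unit cube without changing [p]. *)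
  pose x' : X := fun i => if i.2 \in servers N i.1 then x i.1 i.2 else 0.
  have px : p x' = r.
    by apply/funext => k; rewrite -xr; apply: eq_bigr => j jk; rewrite /x'/= jk.
  have x'1 j : \sum_(k in tasks N j) x' (k, j) <= 1.
    apply: le_trans (x1 j); rewrite le_eqVlt; apply/orP; left; apply/eqP.
    by apply: eq_bigr => k; rewrite finset.inE /x'/= => ->.
  have x'0 i : 0 <= x' i by rewrite /x'; case: ifPn => // /x0.
  exists x' => //; split; last first.
    by split=> [j _|k _] /=; [exact: x'1|rewrite px].
  move=> [k j]; rewrite /= in_itv/= x'0/=.
  have [jk|jk] := boolP (j \in servers N k); last by rewrite /x'/= (negbTE jk).
  apply: le_trans (x'1 j); rewrite (bigD1 k) ?finset.inE//=.
  by rewrite lerDl sumr_ge0.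
have S0 : S !=set0.
  by have [r /PS[x Sx _]] := C0; exists x.
pose f (x : X) : R := \sum_k (z k - p x k) ^+ 2.
have fc : continuous f.
  apply: (@continuous_sumr _ X _ _ _ (fun k x => (z k - p x k) ^+ 2)) => k x.
  apply: (@continuous_comp _ _ _ (p ^~ k) (fun y : R => (z k - y) ^+ 2)).
    exact: pc.
  apply: (@continuous_comp _ _ _ (fun y : R => z k - y) (fun y : R => y ^+ 2)).
    by apply: cvgB; [exact: cvg_cst|exact: cvg_id].
  exact: exprn_continuous.
have [x Sx xmin] := compact_EVT_min S0 Sc (continuous_subspaceT fc).
exists (p x); first by apply: SP; rewrite inE in Sx.
move=> r /PS[x' Sx' <-]; apply: ler_wsqrtr; apply: xmin.
by rewrite inE.
Qed.

(** Moving from the projection [y] towards [c] cannot reduce the distance to [z], so the inner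
    product [a] of [z - y] and [c - y] is nonpositive; expanding the square of [(z - y) + (y - c)]
    then gives the bound. *)
Lemma euclid_proj_contracts (R : realType) (M K J : nat)
    (N : network R M K J) eps0 (z c : 'I_K -> R) :
  allocations_ge N eps0 c ->
  let y := euclid_proj (allocations_ge N eps0) z in
  allocations_ge N eps0 y /\
  \sum_k (y k - c k) ^+ 2 <= \sum_k (z k - c k) ^+ 2.
Proof.
move=> Cc; set y := euclid_proj _ _.
have [y0 Cy0 y0min] := allocations_ge_nearest z (ex_intro _ c Cc).
have [Cy ymin] : allocations_ge N eps0 y /\
    forall r, allocations_ge N eps0 r -> l2dist z y <= l2dist z r.
  by rewrite /y /euclid_proj; case: xgetP => [? ->//|/(_ y0)[]].
split=> //.
pose a : R := \sum_k (z k - y k) * (c k - y k).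
pose b : R := \sum_k (c k - y k) ^+ 2.
have b0 : 0 <= b by apply: sumr_ge0 => k _; exact: sqr_ge0.
have ab t : 0 < t <= 1 -> 2 * a <= t * b.
  move=> /andP[t0 t1]; have t01 : 0 <= t <= 1 by rewrite ltW.
  have := ymin _ (allocations_ge_convex Cy Cc t01).
  rewrite ler_sqrt; last by apply: sumr_ge0 => k _; exact: sqr_ge0.
  have -> : \sum_k (z k - (y k + t * (c k - y k))) ^+ 2 =
      \sum_k (z k - y k) ^+ 2 + (t * (t * b) - t * (2 * a)).
    rewrite /a /b !mulr_sumr -sumrB -big_split/=.
    by apply: eq_bigr => k _; ring.
  by rewrite lerDl subr_ge0 ler_pM2l.
have a0 : a <= 0.
  rewrite leNgt; apply/negP => a0.
  (* With this [t] the bound becomes [2 * a * (a + b) <= a * b], impossible for [a > 0] and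
     [b >= 0]. *)
  have := ab (a / (a + b)).
  rewrite divr_gt0 ?ltr_wpDr//= ler_pdivrMr ?ltr_wpDr// mul1r lerDl => /(_ b0).
  rewrite mulrAC ler_pdivlMr ?ltr_wpDr//; nra.
have -> : \sum_k (z k - c k) ^+ 2 =
    \sum_k (z k - y k) ^+ 2 - 2 * a + \sum_k (y k - c k) ^+ 2.
  rewrite /a mulr_sumr -sumrB -big_split/=.
  by apply: eq_bigr => k _; ring.
rewrite lerDr; have : 0 <= \sum_k (z k - y k) ^+ 2.
  by apply: sumr_ge0 => k _; exact: sqr_ge0.
lra.
Qed.

(** * Telescoping along paths *)

(** Reachability without return is a strict order, and by acyclicity every edge increases it; a
    sequence sorted for it has no repetition. *)
Lemma network_path_uniq (R : realType) (M K J : nat) (N : network R M K J) k c :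
  path (edge N) k c -> uniq (k :: c).
Proof.
move=> kc; pose lt := [rel x y | connect (edge N) x y && ~~ connect (edge N) y x].
apply: (@sorted_uniq _ lt) => [y x z /andP[xy yx] /andP[yz zy]|x|].
- apply/andP; split; first exact: connect_trans xy yz.
  by apply: contra zy => zx; exact: connect_trans zx xy.
- by rewrite /= connect0.
apply: sub_path kc => x y xy; rewrite /= connect1//=.
apply/negP => /connectP[c' yc' lc'].
have /= := @edge_acyclic _ _ _ _ N (y :: c'); rewrite rcons_path yc' -lc' xy.
by move=> /(_ isT).
Qed.

(** The differences telescope from the source value 0 to [g k]. As [path_queues] is a set, the
    absence of repeated nodes is what identifies the sum over it with the sum over the list of
    queues. *)
Lemma sum_path_queues (R : realType) (M K J : nat) (N : network R M K J) k s
    (g : 'I_K -> R) :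
  root_path N k s ->
  \sum_(q in path_queues N s) (g (tgt q) - src_val g q) = g k.
Proof.
case: s => // i t /= /and3P[ri it /eqP <-].
pose F (x : option 'I_K * 'I_K) : R := g x.2 - (if x.1 is Some k' then g k' else 0).
set z := zip (None :: map Some (i :: t)) (i :: t).
have zE : z = (None, i) :: zip (map Some (i :: t)) t by [].
have zq x : x \in z -> is_queue N x.
  rewrite zE inE => /predU1P[-> //|]; elim: t i it {ri z zE} => //= j t IH i.
  by move=> /andP[ij jt]; rewrite inE => /predU1P[-> //|]; exact: IH.
have zU : uniq z.
  apply: (@map_uniq _ _ snd); rewrite -/(unzip2 _) unzip2_zip ?(network_path_uniq it)//.
  by rewrite /= size_map.
transitivity (\sum_(x <- z) F x).
  rewrite big_uniq//= (eq_bigl (fun x => is_queue N x && (x \in z))); last first.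
    by move=> x; case: (boolP (x \in z)) => [/zq->|]; rewrite ?andbF.
  rewrite [RHS](big_sub_cond (is_queue N) (fun x => x \in z)).
  apply: eq_big => [q|q _]; first by rewrite finset.inE.
  by [].
rewrite zE big_cons {1}/F/= subr0; elim: t i it {ri z zE zq zU} => [|j t IH] i /=.
  by rewrite big_nil addr0.
by move=> /andP[_ jt]; rewrite big_cons {1}/F/= addrCA addrA subrK IH.
Qed.

(** * Interpolation between squares *)

(** The distance from [n] to the last square [j ^ 2] below it is at most [2 * j], of order the
    square root of [n], so bounded increments move [f] negligibly in between. *)
Lemma sublinear_squares (R : realType) (C : R) (f : nat -> R) :
  (forall n, `|f n.+1 - f n| <= C) ->
  (fun j => f (j.+1 ^ 2)%N / (j.+1 ^ 2)%:R) @ \oo --> (0 : R) ->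
  sublinear f.
Proof.
move=> fC f0 e e0; have e20 : 0 < e / 2 by rewrite divr_gt0.
have C0 : 0 <= C by exact: le_trans (fC 0%N).
have fD n m : `|f (n + m)%N - f n| <= C * m%:R.
  elim: m => [|m IH]; first by rewrite addn0 subrr normr0 mulr0.
  rewrite addnS (_ : _ - _ = (f (n + m).+1 - f (n + m)%N) + (f (n + m)%N - f n)).
    by rewrite (le_trans (ler_normD _ _))// -natr1 mulrDr mulr1 addrC lerD.
  by ring.
have /cvgrPdist_le/(_ _ e20)[j0 _ j0P] := f0.
pose D := `|f 0%N| + C * (j0 ^ 2)%:R.
have sqle j : `|f (j ^ 2)%N| <= e / 2 * (j ^ 2)%:R + D.
  have [jj0|] := leqP j j0.
    have := fD 0%N (j ^ 2)%N; rewrite add0n => h.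
    have : C * (j ^ 2)%:R <= C * (j0 ^ 2)%:R by rewrite ler_wpM2l// ler_nat leq_sqr.
    have : 0 <= e / 2 * (j ^ 2)%:R by rewrite mulr_ge0// ltW.
    have := ler_normD (f (j ^ 2)%N - f 0%N) (f 0%N); rewrite subrK /D; lra.
  case: j => // j j0j; have := j0P j j0j.
  have j2 : 0 < (j.+1 ^ 2)%:R :> R by rewrite ltr0n expn_gt0.
  rewrite /= sub0r normrN normrM normfV (ger0_norm (ltW j2)) ler_pdivrMr// => h.
  by rewrite (le_trans h)// lerDl addr_ge0// mulr_ge0.
exists (D + C ^+ 2 / (2 * e) * 4) => n.
have [j /andP[jn nj]] : exists j, (j ^ 2 <= n < j.+1 ^ 2)%N.
  elim: n => [|n [j /andP[jn nj]]]; first by exists 0%N.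
  have [h|h] := ltnP n.+1 (j.+1 ^ 2); first by exists j; rewrite h leqW.
  by exists j.+1; rewrite h (leq_ltn_trans nj)// ltn_sqr.
have := fD (j ^ 2)%N (n - j ^ 2)%N; rewrite subnKC// => h.
have : C * (n - j ^ 2)%:R <= C * (2 * j%:R).
  rewrite ler_wpM2l// -natrM ler_nat leq_subLR.
  by move: nj; rewrite -[j.+1]addn1 sqrnD exp1n muln1; lia.
have : (j ^ 2)%:R <= n%:R :> R by rewrite ler_nat.
have := sqle j; have := ler_normD (f n - f (j ^ 2)%N) (f (j ^ 2)%N).
rewrite subrK natrX.
have : 2 * (C * j%:R) <= e / 2 * j%:R ^+ 2 + C ^+ 2 / (2 * e) * 4.
  rewrite -subr_ge0.
  have -> : e / 2 * j%:R ^+ 2 + C ^+ 2 / (2 * e) * 4 - 2 * (C * j%:R) =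
      e / 2 * (j%:R - 2 * C / e) ^+ 2 by field; rewrite gt_eqF.
  by rewrite mulr_ge0 ?sqr_ge0// ltW.
have : e / 2 * j%:R ^+ 2 <= e / 2 * n%:R.
  by rewrite ler_wpM2l ?(ltW e20)// -natrX ler_nat.
by move=> *; lra.
Qed.

(** * Bounded measurable functions *)

(** No measure enters, so the same predicate serves for [T] and for [T] carrying the smaller
    sigma-algebra of a history. *)
Definition bounded_measurable (R : realType) (d : measure_display)
    (T : measurableType d) (f : T -> R) : Prop :=
  measurable_fun setT f /\ exists C, forall w, `|f w| <= C.

Section BoundedMeasurable.
Context {R : realType} {d : measure_display} {T : measurableType d}.
Implicit Types f g : T -> R.

Lemma bounded_measurable_cst (c : R) : bounded_measurable (fun _ : T => c).
Proof. by split; [exact: measurable_cst|exists `|c|]. Qed.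

Lemma bounded_measurableD f g :
  bounded_measurable f -> bounded_measurable g ->
  bounded_measurable (fun w => f w + g w).
Proof.
move=> [mf [C fC]] [mg [D gD]]; split; first exact: measurable_funD.
by exists (C + D) => w; rewrite (le_trans (ler_normD _ _))// lerD.
Qed.

Lemma bounded_measurableM f g :
  bounded_measurable f -> bounded_measurable g ->
  bounded_measurable (fun w => f w * g w).
Proof.
move=> [mf [C fC]] [mg [D gD]]; split; first exact: measurable_funM.
by exists (C * D) => w; rewrite normrM ler_pM.
Qed.

Lemma bounded_measurableB f g :
  bounded_measurable f -> bounded_measurable g ->
  bounded_measurable (fun w => f w - g w).
Proof.
move=> [mf [C fC]] [mg [D gD]]; split; first exact: measurable_funB.
by exists (C + D) => w; rewrite (le_trans (ler_normB _ _))// lerD.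
Qed.

Lemma bounded_measurable_sum (I : Type) (r : seq I) (Pr : pred I)
    (f : I -> T -> R) :
  (forall i, bounded_measurable (f i)) ->
  bounded_measurable (fun w => \sum_(i <- r | Pr i) f i w).
Proof.
move=> bf; elim: r => [|i r IH].
  rewrite (_ : (fun w => _) = (fun=> 0)); first exact: bounded_measurable_cst.
  by apply/funext => w; rewrite big_nil.
rewrite (_ : (fun w => _) =
    (fun w => (if Pr i then f i w else 0) + \sum_(j <- r | Pr j) f j w)).
  apply: bounded_measurableD => //; case: (Pr i) => //.
  exact: bounded_measurable_cst.
by apply/funext => w; rewrite big_cons; case: (Pr i); rewrite ?add0r.
Qed.

Lemma bounded_measurable_bool (b : T -> bool) :
  measurable_fun setT b -> bounded_measurable (fun w => (b w)%:R : R).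
Proof.
move=> mb; split; last first.
  by exists 1 => w; case: (b w); rewrite ?normr1 ?normr0.
by apply: (measurableT_comp (f := fun x : bool => x%:R : R)).
Qed.

End BoundedMeasurable.

(** * Expectations and almost sure limits *)

Section Expectation.
Context {R : realType} {d : measure_display} {T : measurableType d}
  (P : probability T R).
Implicit Types f g : T -> R.

Definition mean f : R := \int[P]_w f w.

Let measure_setT1 : (P : {measure set T -> \bar R}) [set: T] = 1%E.
Proof. exact: probability_setT. Qed.

Lemma bounded_measurable_integrable f :
  bounded_measurable f -> P.-integrable setT (EFin \o f).
Proof.
move=> [mf [C fC]]; apply: measurable_bounded_integrable => //.
  by rewrite measure_setT1 ltry.
by exists C; split=> [|D CD w _]; [exact: num_real|exact: le_trans (fC w) (ltW CD)].
Qed.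

Hint Resolve bounded_measurable_integrable : core.

Lemma mean_cst (c : R) : mean (fun=> c) = c.
Proof. by rewrite /mean Rintegral_cst// measure_setT1 mulr1. Qed.

Lemma meanD f g : bounded_measurable f -> bounded_measurable g ->
  mean (fun w => f w + g w) = mean f + mean g.
Proof. by move=> bf bg; rewrite /mean RintegralD//; auto. Qed.

Lemma meanB f g : bounded_measurable f -> bounded_measurable g ->
  mean (fun w => f w - g w) = mean f - mean g.
Proof. by move=> bf bg; rewrite /mean RintegralB//; auto. Qed.

Lemma meanZ (c : R) f : bounded_measurable f ->
  mean (fun w => c * f w) = c * mean f.
Proof. by move=> bf; rewrite /mean RintegralZl//; auto. Qed.

Lemma mean_sum (I : Type) (r : seq I) (Pr : pred I) (f : I -> T -> R) :
  (forall i, bounded_measurable (f i)) ->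
  mean (fun w => \sum_(i <- r | Pr i) f i w) = \sum_(i <- r | Pr i) mean (f i).
Proof.
move=> bf; elim: r => [|i r IH].
  rewrite big_nil (_ : (fun w => _) = (fun=> 0)) ?mean_cst//.
  by apply/funext => w; rewrite big_nil.
rewrite big_cons -IH; case: ifPn => [Pi|/negbTE nPi].
  rewrite -meanD//; last exact: bounded_measurable_sum.
  by congr mean; apply/funext => w; rewrite big_cons Pi.
by congr mean; apply/funext => w; rewrite big_cons nPi.
Qed.

Lemma mean_le f g : bounded_measurable f -> bounded_measurable g ->
  (forall w, f w <= g w) -> mean f <= mean g.
Proof. by move=> bf bg fg; rewrite /mean le_Rintegral//; auto. Qed.

Lemma mean_ge0 f : (forall w, 0 <= f w) -> 0 <= mean f.
Proof. by move=> f0; apply: Rintegral_ge0 => w _. Qed.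

Lemma mean_norm_le f (C : R) : bounded_measurable f ->
  (forall w, `|f w| <= C) -> `|mean f| <= C.
Proof.
move=> bf fC; rewrite ler_norml; apply/andP; split.
  rewrite -[leLHS]mean_cst; apply: mean_le => // [|w].
    exact: bounded_measurable_cst.
  by have := fC w; rewrite ler_norml => /andP[].
rewrite -[leRHS]mean_cst; apply: mean_le => // [|w].
  exact: bounded_measurable_cst.
exact: le_trans (ler_norm _) (fC w).
Qed.

(** By monotone convergence the sum of the whole series has integral at most [B], hence is finite
    almost everywhere. *)
Lemma ae_cvg_series (f : nat -> T -> R) (B : R) :
  (forall n, bounded_measurable (f n)) -> (forall n w, 0 <= f n w) ->
  (forall n, \sum_(0 <= i < n) mean (f i) <= B) ->
  {ae P, forall w, cvgn (series (f ^~ w))}.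
Proof.
move=> bf f0 fB.
have mf n : measurable_fun setT (EFin \o f n).
  by apply/measurable_EFinP; case: (bf n).
have fE n : (\int[P]_w (f n w)%:E = (mean (f n))%:E)%E.
  rewrite /mean /Rintegral fineK//.
  exact: (@integrable_fin_num _ _ _ P setT _ (EFin \o f n)) (bounded_measurable_integrable (bf n)).
have intf : P.-integrable setT (fun w => (\sum_(n <oo) (f n w)%:E)%E).
  apply/integrableP; split.
    apply: (@ge0_emeasurable_sum _ _ _ setT (fun n w => (f n w)%:E) xpredT).
      by move=> n w _ _; rewrite lee_fin.
    by move=> n _; exact: mf.
  rewrite (eq_integral (fun w => (\sum_(n <oo) (f n w)%:E)%E)); last first.
    by move=> w _; rewrite gee0_abs//; apply: nneseries_ge0 => n _ _; rewrite lee_fin.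
  rewrite integral_nneseries//; last by move=> n w _; rewrite lee_fin.
  under eq_eseriesr do rewrite fE.
  apply: (@le_lt_trans _ _ B%:E); last by rewrite ltry.
  apply: lime_le.
    by apply: is_cvg_nneseries => n _ _; rewrite lee_fin mean_ge0.
  by apply: nearW => n; rewrite sumEFin lee_fin.
apply: filterS (integrable_ae measurableT intf) => w /(_ Logic.I) fin.
apply: nondecreasing_is_cvgn.
  by apply: nondecreasing_series => n _ _.
exists (fine (\sum_(n <oo) (f n w)%:E)%E) => _ [n _ <-].
rewrite -lee_fin fineK// /series/= -sumEFin.
by apply: nneseries_lim_ge => i _ _; rewrite lee_fin.
Qed.

Lemma sum_inv_sqr_le (n : nat) : \sum_(0 <= j < n) (j.+1%:R ^+ 2)^-1 <= 2 :> R.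
Proof.
(* Subtracting [2 / n.+1%:R] makes the induction close. *)
suff : \sum_(0 <= j < n) (j.+1%:R ^+ 2)^-1 <= 2 - 2 / n.+1%:R :> R.
  by move=> h; rewrite (le_trans h)// lerBlDr lerDl divr_ge0.
elim: n => [|n IH]; first by rewrite big_nil divr1 subrr.
rewrite big_nat_recr//= (le_trans (lerD IH (lexx _)))// -subr_ge0.
have -> : 2 - 2 / n.+2%:R - (2 - 2 / n.+1%:R + (n.+1%:R ^+ 2)^-1) =
    n%:R / (n.+2%:R * n.+1%:R ^+ 2) :> R.
  by rewrite -!natr1; field; rewrite !natr1 !pnatr_eq0.
by rewrite divr_ge0// mulr_ge0// sqr_ge0.
Qed.

(* Orthogonality gives [E S_n^2 <= n C^2], so that [S_(j^2) / j^2] is square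
   summable; the increments are bounded, which fills the gaps between squares. *)
Lemma ae_sublinear_series (X : nat -> T -> R) (C : R) :
  (forall n, bounded_measurable (X n)) -> (forall n w, `|X n w| <= C) ->
  (forall n, mean (fun w => series (X ^~ w) n * X n w) = 0) ->
  {ae P, forall w, sublinear (series (X ^~ w))}.
Proof.
move=> bX XC orth.
have bS n : bounded_measurable (fun w => series (X ^~ w) n).
  exact: bounded_measurable_sum.
have ES n : mean (fun w => series (X ^~ w) n ^+ 2) <= C ^+ 2 * n%:R.
  elim: n => [|n IH].
    rewrite (_ : (fun w => _) = (fun=> 0)) ?mean_cst ?mulr0//.
    by apply/funext => w; rewrite /series/= big_nil expr0n.
  rewrite (_ : (fun w => _) = (fun w => series (X ^~ w) n * series (X ^~ w) n +
      (2 * (series (X ^~ w) n * X n w) + X n w * X n w))); last first.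
    by apply/funext => w; rewrite seriesSr; ring.
  have bSS := bounded_measurableM (bS n) (bS n).
  have bSX := bounded_measurableM (bS n) (bX n).
  have bXX := bounded_measurableM (bX n) (bX n).
  have b2 : bounded_measurable (fun w => 2 * (series (X ^~ w) n * X n w)).
    exact: bounded_measurableM (bounded_measurable_cst 2) bSX.
  rewrite (meanD bSS (bounded_measurableD b2 bXX)) (meanD b2 bXX) meanZ//.
  rewrite orth mulr0 add0r -natr1 mulrDr mulr1 lerD//.
  rewrite -[leRHS]mean_cst; apply: mean_le => // [|w].
    exact: bounded_measurable_cst.
  rewrite -expr2 -(real_normK (num_real (X n w))).
  by rewrite lerXn2r ?nnegrE ?(le_trans (normr_ge0 _) (XC n w))//.
pose f j w := (series (X ^~ w) (j.+1 ^ 2)%N / (j.+1 ^ 2)%:R) ^+ 2.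
have bf j : bounded_measurable (f j).
  rewrite /f; under eq_fun do rewrite expr2.
  have b : bounded_measurable (fun w => series (X ^~ w) (j.+1 ^ 2)%N / (j.+1 ^ 2)%:R).
    exact: bounded_measurableM (bS _) (bounded_measurable_cst _).
  exact: (bounded_measurableM b b).
have fB n : \sum_(0 <= i < n) mean (f i) <= C ^+ 2 * 2.
  apply: le_trans (ler_wpM2l (sqr_ge0 C) (sum_inv_sqr_le n)).
  rewrite mulr_sumr; apply: ler_sum => j _.
  have -> : mean (f j) =
      ((j.+1 ^ 2)%:R ^+ 2)^-1 * mean (fun w => series (X ^~ w) (j.+1 ^ 2)%N ^+ 2).
    rewrite -meanZ//; last by under eq_fun do rewrite expr2; exact: bounded_measurableM.
    by congr mean; apply/funext => w; rewrite /f expr_div_n mulrC.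
  rewrite mulrC ler_pdivrMr ?exprn_gt0 ?ltr0n ?expn_gt0//.
  rewrite (le_trans (ES _))// le_eqVlt; apply/orP; left; apply/eqP.
  by rewrite natrX; field; rewrite nat1r pnatr_eq0.
have f0 j w : 0 <= f j w by exact: sqr_ge0.
apply: filterS (ae_cvg_series bf f0 fB) => w /cvg_series_cvg_0 fw.
apply: (@sublinear_squares _ C) => [n|]; first by rewrite seriesSB.
apply/cvgrPdist_le => e e0.
have /cvgrPdist_le/(_ (e ^+ 2)) := fw; rewrite exprn_gt0// => /(_ isT).
apply: filterS => j; rewrite !sub0r !normrN (ger0_norm (f0 j w)) => h.
by rewrite -(@ler_pXn2r _ 2)// ?nnegrE// ?(ltW e0)// real_normK ?num_real.
Qed.

End Expectation.

(** * Conditional probabilities tested against measurable functions *)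

(** The sum counts the positive integers up to [y]: it is the integer part of [y], written as a sum
    of layers. *)
Lemma layer_count (R : realType) (y : R) (L : nat) : 0 <= y <= L%:R ->
  0 <= y - \sum_(0 <= i < L) (i.+1%:R <= y)%R%:R <= 1.
Proof.
elim: L => [|L IH] /andP[y0 yL].
  by rewrite big_nil subr0 y0 (le_trans yL).
rewrite big_nat_recr//=; have [yL'|Ly] := leP y L%:R.
  rewrite (_ : (L.+1%:R <= y) = false) ?addr0 ?IH ?y0//.
  by apply/negbTE; rewrite -ltNge (le_lt_trans yL')// ltr_nat.
have -> : \sum_(0 <= i < L) (i.+1%:R <= y)%R%:R = L%:R :> R.
  rewrite -[in RHS](subn0 L) -sumr_const_nat big_nat [RHS]big_nat.
  apply: eq_bigr => i /andP[_ iL].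
  by rewrite (le_trans _ (ltW Ly))// ler_nat.
rewrite -natr1 in yL *; case: (leP (L%:R + 1) y) => h /=; lra.
Qed.

Section ConditionalProbability.
Context {R : realType} {d : measure_display} {T : measurableType d}
  (P : probability T R) (gen : set_system T).
Hypothesis gen_meas : gen `<=` measurable.

Let G : set_system T := <<s gen >>.
Let TG : measurableType _ := g_sigma_algebraType gen.

Let G_meas : G `<=` measurable.
Proof. by apply: smallest_sub => //; exact: sigma_algebra_measurable. Qed.

Lemma bounded_measurable_sub (f : T -> R) :
  bounded_measurable (f : TG -> R) -> bounded_measurable f.
Proof.
move=> [mf bf]; split => // _ B mB; rewrite setTI; apply: G_meas.
by have := mf measurableT B mB; rewrite setTI.
Qed.

(** A shift of [Y], scaled by [m.+1], is within 1 of a finite sum of indicators of sets in [G], each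
    orthogonal to [g]. Hence [m.+1] times the absolute value of the mean stays below the bound [D]
    of [g] for every [m], so the mean is 0. *)
Lemma mean_layers (g Y : T -> R) :
  bounded_measurable g ->
  (forall A, G A -> mean P (fun w => \1_A w * g w) = 0) ->
  bounded_measurable (Y : TG -> R) ->
  mean P (fun w => Y w * g w) = 0.
Proof.
move=> bg g0 bY; have bYT := bounded_measurable_sub bY.
have [mY [C YC]] := bY; have [mg [D gD]] := bg.
have D0 : 0 <= D by exact: le_trans (normr_ge0 _) (gD point).
have b1 A : G A -> bounded_measurable (\1_A : T -> R).
  move=> GA; split; first exact: measurable_indic (G_meas GA).
  by exists 1 => w; rewrite indicE; case: (_ \in _); rewrite ?normr1 ?normr0.
have GT : G setT.
  exact: (@measurableT _ TG).
have mean_g : mean P g = 0.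
  rewrite -[RHS](g0 setT)//; congr mean; apply/funext => w.
  by rewrite indicT mul1r.
have layer m : m.+1%:R * `|mean P (fun w => Y w * g w)| <= D.
  pose y w := m.+1%:R * (Y w + C).
  have bC := bounded_measurable_cst (T := T) C.
  have bm := bounded_measurable_cst (T := T) (m.+1%:R : R).
  have by_ : bounded_measurable y.
    exact: (bounded_measurableM bm (bounded_measurableD bYT bC)).
  pose L := (Num.truncn (m.+1%:R * (C + C))).+1.
  have yL w : 0 <= y w <= L%:R.
    have := YC w; rewrite ler_norml => /andP[h1 h2].
    rewrite mulr_ge0//=; last by lra.
    rewrite (le_trans _ (ltW (truncnS_gt _)))// ler_wpM2l// lerD2r.
    exact: h2.
  pose A i := [set w | i.+1%:R <= y w].
  have GA i : G (A i).
    have -> : A i = (fun w => Y w) @^-1` `[i.+1%:R / m.+1%:R - C, +oo[.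
      apply/seteqP; split=> w; rewrite /A/= in_itv/= andbT lerBlDr ler_pdivrMr//;
      by rewrite mulrC.
    by have := mY measurableT _ (measurable_itv `[i.+1%:R / m.+1%:R - C, +oo[); rewrite setTI.
  pose S w : R := \sum_(0 <= i < L) \1_(A i) w.
  have bS : bounded_measurable S by apply: bounded_measurable_sum => i; exact: b1.
  have yS w : `|y w - S w| <= 1.
    have := layer_count (yL w).
    have -> : S w = \sum_(0 <= i < L) (i.+1%:R <= y w)%R%:R.
      by apply: eq_bigr => i _; rewrite indicE; congr (_%:R); rewrite mem_setE.
    by move=> /andP[h1 h2]; rewrite ger0_norm.
  have Sg : mean P (fun w => S w * g w) = 0.
    rewrite (_ : (fun w => _) = (fun w => \sum_(0 <= i < L) \1_(A i) w * g w)).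
      rewrite mean_sum; first by rewrite big1// => i _; exact: g0.
      by move=> i; apply: bounded_measurableM => //; exact: b1.
    by apply/funext => w; rewrite mulr_suml.
  have bYg := bounded_measurableM bYT bg.
  have bCg := bounded_measurableM bC bg.
  have bSg := bounded_measurableM bS bg.
  have : mean P (fun w => (y w - S w) * g w) = m.+1%:R * mean P (fun w => Y w * g w).
    rewrite (_ : (fun w => _) =
      (fun w => m.+1%:R * (Y w * g w + C * g w) - S w * g w)); last first.
      by apply/funext => w; rewrite /y; ring.
    rewrite (meanB P (bounded_measurableM bm (bounded_measurableD bYg bCg)) bSg).
    rewrite (meanZ P _ (bounded_measurableD bYg bCg)) (meanD P bYg bCg) (meanZ P _ bg).
    by rewrite Sg mean_g mulr0 addr0 subr0.
  rewrite -[m.+1%:R * `|_|]ger0_norm ?mulr_ge0// normrM normr_id -normrM => <-.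
  apply: mean_norm_le => [|w].
    exact: (bounded_measurableM (bounded_measurableB by_ bS) bg).
  by rewrite normrM -[leRHS]mul1r ler_pM.
apply/eqP; rewrite -normr_eq0; apply: contraT => n0.
have {}n0 : 0 < `|mean P (fun w => Y w * g w)| by rewrite lt0r n0 normr_ge0.
have := layer (Num.truncn (D / `|mean P (fun w => Y w * g w)|)).
by rewrite leNgt -ltr_pdivrMr// truncnS_gt.
Qed.

(** By definition of conditional probability [X - r] has integral 0 over every set of [G];
    [mean_layers] extends this to the weights [Y]. *)
Lemma mean_cond_prob (X : T -> bool) (r Y : T -> R) :
  measurable_fun setT X -> bounded_measurable r ->
  is_cond_prob P G [set w | X w = true] r ->
  bounded_measurable (Y : TG -> R) ->
  mean P (fun w => Y w * (X w)%:R) = mean P (fun w => Y w * r w).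
Proof.
move=> mX br [_ Xr] bY.
have bX := bounded_measurable_bool mX : bounded_measurable (fun w => (X w)%:R : R).
have bYT := bounded_measurable_sub bY.
apply/eqP; rewrite -subr_eq0 -meanB; do ?exact: bounded_measurableM.
apply/eqP; rewrite (_ : (fun w => _) = (fun w => Y w * ((X w)%:R - r w))); last first.
  by apply/funext => w; rewrite mulrBr.
apply: mean_layers => //; first exact: bounded_measurableB.
move=> A GA; have mA := G_meas GA.
have b1 : bounded_measurable (\1_A : T -> R).
  split; first exact: measurable_indic.
  by exists 1 => w; rewrite indicE; case: (_ \in _); rewrite ?normr1 ?normr0.
rewrite (_ : (fun w => _) = (fun w => \1_A w * (X w)%:R - \1_A w * r w)); last first.
  by apply/funext => w; rewrite mulrBr.
rewrite meanB; do ?exact: bounded_measurableM.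
apply/eqP; rewrite subr_eq0; apply/eqP.
have mB : measurable [set w | X w = true].
  by have := mX measurableT [set true] Logic.I; rewrite setTI.
have -> : mean P (fun w => \1_A w * r w) = fine (\int[P]_(w in A) (r w)%:E)%E.
  rewrite -/(Rintegral P A r) Rintegral_mkcond; congr Rintegral; apply/funext => w.
  by rewrite patchE indicE; case: ifP; rewrite ?mul1r ?mul0r.
have -> : mean P (fun w => \1_A w * (X w)%:R) =
    fine ((P : {measure set T -> \bar R}) (A `&` [set w | X w = true])).
  rewrite /mean /Rintegral -[A `&` _]setIT -integral_indic//; last exact: measurableI.
  congr fine; apply: eq_integral => w _.
  rewrite !indicE in_setI; congr (_%:E).
  have -> : (w \in [set w | X w = true]) = X w.
    by apply/idP/idP => [/set_mem|Xw]; [|exact: mem_set].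
  by case: (w \in A); case: (X w); rewrite ?mul1r ?mul0r.
congr fine; exact: Xr.
Qed.

End ConditionalProbability.

(** * The network under the policy: queues and backlogs *)

Section Policy.
Context {R : realType} {M K J : nat} {N : network R M K J}
  {d : measure_display} {T : measurableType d} (P : probability T R)
  (lam : 'I_M -> R) (eps0 : R) (beta : nat -> R) (hpath : 'I_K -> seq 'I_K)
  (a : nat -> 'I_M -> T -> bool) (s : nat -> 'I_K -> T -> bool)
  (Q : nat -> queue N -> T -> nat) (p : nat -> 'I_K -> T -> R).
Hypothesis lam01 : forall m, 0 < lam m < 1.
Hypothesis lam_capacity : capacity_region N lam.
Hypothesis eps0_le : forall k, eps0 <= lam (cls N k) / mu N k.
Hypothesis beta_gt0 : forall n, 0 < beta n.
Hypothesis beta_decr : nonincreasing_seq beta.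
Hypothesis beta_sqr_sum : cvgn (series (fun n => beta n ^+ 2)).
Hypothesis beta_lim : cvgn (fun n : nat => (n%:R * beta n)^-1).
Hypothesis hpath_path : forall k, root_path N k (hpath k).
Hypothesis a_meas : forall n m, measurable_fun setT (a n m).
Hypothesis s_meas : forall n k, measurable_fun setT (s n k).
Hypothesis Q_meas : forall n q, measurable_fun setT (Q n q).
Hypothesis p_meas : forall n k, measurable_fun setT (p n k).
Hypothesis p0_alloc : forall w, allocations N (p 0 ^~ w).
Hypothesis Q_step : forall n q w,
  (Q n.+1 q w + completed s Q n (tgt q) w = Q n q w + inflow a s Q n q w)%N.
Hypothesis p_step : forall n w,
  (fun k => p n.+1 k w) =
  euclid_proj (allocations_ge N eps0)
    (fun k => p n k w + beta n * policy_update hpath Q n k w).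
Hypothesis cond_law : forall n,
  cond_indep_bernoulli P (history Q p n)
    (fun i : 'I_M + 'I_K => match i with inl m => a n m | inr k => s n k end)
    (fun i w => match i with inl m => lam m | inr k => mu N k * p n k w end).

Let avail n k w : R := (available (fun q => Q n q w) k)%:R.
Let nu k : R := lam (cls N k).
Let target k : R := nu k / mu N k.

Definition net_arrival n k w : R :=
  (a n (cls N k) w)%:R - (completed s Q n k w)%:R.

(** The process [W_k] of the overview, with increments [net_arrival]. *)
Definition backlog n k w : R := series (fun i => net_arrival i k w) n.

Lemma queue_increment n q w :
  (Q n.+1 q w)%:R - (Q n q w)%:R =
  net_arrival n (tgt q) w - src_val (net_arrival n ^~ w) q :> R.
Proof.
have /(congr1 (fun x => x%:R : R)) := Q_step n q w; rewrite !natrD.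
case: q => -[[k'|] k] qP; rewrite /inflow /src_val /net_arrival /src /tgt/=.
  by rewrite (edge_cls qP); lra.
lra.
Qed.

Lemma queue_backlog n q w :
  (Q n q w)%:R =
  (Q 0 q w)%:R + backlog n (tgt q) w - src_val (backlog n ^~ w) q :> R.
Proof.
elim: n => [|n IH].
  by rewrite /src_val; case: src => [k'|]; rewrite /backlog /series/= !big_nil; ring.
have := queue_increment n q w.
have -> : src_val (backlog n.+1 ^~ w) q =
    src_val (backlog n ^~ w) q + src_val (net_arrival n ^~ w) q.
  by rewrite /src_val; case: src => [k'|]; rewrite ?addr0// /backlog seriesSr.
by rewrite /backlog seriesSr -/(backlog n _ w) IH; lra.
Qed.

(** The queue increments telescope along the path, so the update at [k] sees only the arrivals of
    its class and its own completions, whichever path is chosen. *)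
Lemma policy_updateE n k w :
  policy_update hpath Q n k w = avail n k w * net_arrival n k w.
Proof.
rewrite /policy_update; congr (_ * _).
rewrite -[RHS](sum_path_queues (net_arrival n ^~ w) (hpath_path k)).
by apply: eq_bigr => q _; exact: queue_increment.
Qed.

Lemma backlog_path n k w :
  backlog n k w =
  \sum_(q in path_queues N (hpath k)) ((Q n q w)%:R - (Q 0 q w)%:R).
Proof.
rewrite -[LHS](sum_path_queues (backlog n ^~ w) (hpath_path k)).
by apply: eq_bigr => q _; rewrite queue_backlog; ring.
Qed.

Lemma allocation_mem n w : allocations N (p n ^~ w).
Proof.
case: n => // n; rewrite p_step.
have [[]] := euclid_proj_contracts
  (fun k => p n k w + beta n * policy_update hpath Q n k w)
  (allocations_target lam_capacity eps0_le).
by [].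
Qed.

(** * Measurability with respect to the history *)

Let gen n : set_system T := [set A | exists2 i, (i <= n)%N &
  (exists q (B : set nat), A = Q i q @^-1` B) \/
  (exists k (B : set R), measurable B /\ A = p i k @^-1` B)].

Let H n : measurableType _ := g_sigma_algebraType (gen n).

Let gen_meas n : gen n `<=` measurable.
Proof.
move=> A [i _ [[q [B ->]]|[k [B [mB ->]]]]].
  by have := Q_meas i q measurableT (Logic.I : measurable B); rewrite setTI.
by have := p_meas i k measurableT mB; rewrite setTI.
Qed.

Lemma bounded_measurable_history n (f : T -> R) :
  bounded_measurable (f : H n -> R) -> bounded_measurable f.
Proof. by move=> bf; exact: (bounded_measurable_sub (@gen_meas n) bf). Qed.

Lemma queue_history n i q (h : nat -> R) : (i <= n)%N ->
  measurable_fun setT ((fun w => h (Q i q w)) : H n -> R).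
Proof.
move=> iN _ B mB; rewrite setTI; apply: sub_sigma_algebra; exists i => //.
by left; exists q, (h @^-1` B).
Qed.

Lemma alloc_history n i k : (i <= n)%N ->
  bounded_measurable (p i k : H n -> R).
Proof.
move=> iN; split.
  move=> _ B mB; rewrite setTI; apply: sub_sigma_algebra; exists i => //.
  by right; exists k, B.
exists (mu N k)^-1 => w; have [p0 p1] := allocations_bound k (allocation_mem i w).
by rewrite ger0_norm// -[leRHS]mul1r ler_pdivlMr ?mu_gt0// mulrC.
Qed.

Lemma avail_history n i k : (i <= n)%N ->
  bounded_measurable (avail i k : H n -> R).
Proof.
move=> iN; split; last first.
  by exists 1 => w; rewrite /avail; case: available; rewrite ?normr1 ?normr0.
have -> : avail i k =
    fun w => \prod_(q : queue N) ((tgt q == k) ==> (0 < Q i q w)%N)%:R.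
  apply/funext => w; rewrite /avail; have [av|] := boolP (available _ k).
    by rewrite big1// => q _; move/forallP: av => /(_ q) ->.
  rewrite negb_forall => /existsP[q /negbTE qF].
  by rewrite (bigD1 q)//= qF mul0r.
apply: measurable_prod => q _.
exact: (@queue_history n i q (fun x => ((tgt q == k) ==> (0 < x)%N)%:R)).
Qed.

(* Arrivals and completions need not be measurable with respect to later
   histories; their difference is, being read off the queues along a path. *)
Lemma net_arrival_history n i k : (i < n)%N ->
  bounded_measurable (net_arrival i k : H n -> R).
Proof.
move=> iN; split; last first.
  exists 1 => w; rewrite /net_arrival.
  by case: (a _ _ _); case: completed; rewrite /= ?subrr ?subr0 ?sub0r ?normrN ?normr1 ?normr0.
have mb m : (m <= n)%N -> measurable_fun setT (backlog m k : H n -> R).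
  move=> mn; rewrite (_ : backlog m k = fun w =>
      \sum_(q in path_queues N (hpath k)) ((Q m q w)%:R - (Q 0 q w)%:R)).
    under eq_fun do rewrite big_mkcond.
    apply: measurable_sum => q; case: (q \in _); last exact: measurable_cst.
    by apply: measurable_funB;
      [exact: (@queue_history _ _ _ (fun x => x%:R))|
       exact: (@queue_history _ 0 _ (fun x => x%:R))].
  by apply/funext => w; exact: backlog_path.
rewrite (_ : net_arrival i k = fun w => backlog i.+1 k w - backlog i k w).
  by apply: measurable_funB; apply: mb => //; exact: ltnW.
by apply/funext => w; rewrite /backlog seriesSr addrC addKr.
Qed.

(** * Drift and martingale noise *)

(** The conditional mean of [net_arrival n k] given the history up to time [n]. *)
Let drift n k w : R := nu k - avail n k w * (mu N k * p n k w).

Lemma drift_history n i k : (i <= n)%N ->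
  bounded_measurable (drift i k : H n -> R).
Proof.
move=> iN; apply: bounded_measurableB; first exact: bounded_measurable_cst.
apply: bounded_measurableM; first exact: avail_history.
apply: bounded_measurableM; first exact: bounded_measurable_cst.
exact: alloc_history.
Qed.

Lemma cond_prob_arrival n m :
  is_cond_prob P (history Q p n) [set w | a n m w = true] (fun=> lam m).
Proof.
have := cond_law n [set inl m]%SET (fun=> true).
rewrite (_ : [set w | _] = [set w | a n m w = true]); last first.
  apply/seteqP; split => w /=; first by move=> /(_ (inl m)); apply; rewrite finset.inE.
  by move=> aw i; rewrite finset.inE => /eqP ->.
rewrite (_ : (fun w => _) = (fun=> lam m))//.
by apply/funext => w; rewrite big_set1.
Qed.

Lemma cond_prob_service n k :
  is_cond_prob P (history Q p n) [set w | s n k w = true]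
    (fun w => mu N k * p n k w).
Proof.
have := cond_law n [set inr k]%SET (fun=> true).
rewrite (_ : [set w | _] = [set w | s n k w = true]); last first.
  apply/seteqP; split => w /=; first by move=> /(_ (inr k)); apply; rewrite finset.inE.
  by move=> aw i; rewrite finset.inE => /eqP ->.
rewrite (_ : (fun w => _) = (fun w => mu N k * p n k w))//.
by apply/funext => w; rewrite big_set1.
Qed.

(** Arrivals are tested against [Y] and services against [Y * avail], which is also determined by
    the history; each is then replaced by its conditional probability. *)
Lemma mean_net_arrival n k (Y : T -> R) :
  bounded_measurable (Y : H n -> R) ->
  mean P (fun w => Y w * net_arrival n k w) = mean P (fun w => Y w * drift n k w).
Proof.
move=> bY.
have bYE : bounded_measurable ((fun w => Y w * avail n k w) : H n -> R).
  by apply: bounded_measurableM => //; exact: avail_history.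
have bmup : bounded_measurable ((fun w => mu N k * p n k w) : H n -> R).
  apply: bounded_measurableM; first exact: bounded_measurable_cst.
  exact: alloc_history.
have ba := bounded_measurable_bool (R := R) (a_meas n (cls N k)).
have bs := bounded_measurable_bool (R := R) (s_meas n k).
have bYT := bounded_measurable_history bY.
have bYET := bounded_measurable_history bYE.
have bmupT := bounded_measurable_history bmup.
have Ea := mean_cond_prob (@gen_meas n) (a_meas n (cls N k))
  (bounded_measurable_cst _) (cond_prob_arrival n (cls N k)) bY.
have Es := mean_cond_prob (@gen_meas n) (s_meas n k) bmupT
  (cond_prob_service n k) bYE.
transitivity (mean P (fun w => Y w * (a n (cls N k) w)%:R) -
              mean P (fun w => Y w * avail n k w * (s n k w)%:R)).
  rewrite -(meanB P (bounded_measurableM bYT ba) (bounded_measurableM bYET bs)).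
  congr mean; apply/funext => w; rewrite /net_arrival /completed /avail.
  by case: (s n k w); rewrite /=; ring.
have bYl := bounded_measurableM bYT (bounded_measurable_cst (lam (cls N k))).
rewrite Ea Es -(meanB P bYl (bounded_measurableM bYET bmupT)).
by congr mean; apply/funext => w; rewrite /drift /nu; ring.
Qed.

Let noise n k w : R := net_arrival n k w - drift n k w.

Lemma noise_history n i k : (i < n)%N ->
  bounded_measurable (noise i k : H n -> R).
Proof.
move=> iN; apply: bounded_measurableB; first exact: net_arrival_history.
by apply: drift_history; exact: ltnW.
Qed.

(** The noise is a bounded martingale difference: its partial sum before [n] is determined by the
    history up to [n], hence orthogonal to the term at time [n]. *)
Lemma ae_noise_sublinear k :
  {ae P, forall w, sublinear (series (fun n => noise n k w))}.
Proof.
apply: (@ae_sublinear_series _ _ _ P (fun n w => noise n k w) 2) => [n|n w|n].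
- exact: bounded_measurable_history (noise_history k (ltnSn n)).
- have [p0 p1] := allocations_bound k (allocation_mem n w).
  have /andP[l0 l1] := lam01 (cls N k).
  have mp0 : 0 <= mu N k * p n k w by rewrite mulr_ge0// ltW// mu_gt0.
  rewrite /noise /net_arrival /drift /avail /nu ler_norml.
  by case: (a _ _ _); case: completed; case: available; apply/andP; split; rewrite /=; lra.
have bY : bounded_measurable ((fun w => series (fun n => noise n k w) n) : H n -> R).
  rewrite /series/=; under eq_fun do rewrite big_mkord.
  by apply: bounded_measurable_sum => i; exact: noise_history.
have bYT := bounded_measurable_history bY.
have bn := bounded_measurable_history (net_arrival_history k (ltnSn n)).
have bd := bounded_measurable_history (drift_history k (leqnn n)).
rewrite /noise; under eq_fun do rewrite mulrBr.
rewrite (meanB P (bounded_measurableM bYT bn) (bounded_measurableM bYT bd)).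
by rewrite mean_net_arrival// subrr.
Qed.

(** * Decrease of the distance to the target *)

Let gap n k w : R := avail n k w * (p n k w - target k).

(** When [k] is available the drift is [- mu * gap], and otherwise the gap is 0; so this is minus
    the conditional mean of [\sum_k gap * net_arrival]. *)
Let energy n w : R := \sum_k mu N k * gap n k w ^+ 2.

Let distance n w : R := \sum_k (p n k w - target k) ^+ 2.

Let mu_target k : mu N k * target k = nu k.
Proof. by rewrite mulrC divfK// gt_eqF// mu_gt0. Qed.

Lemma gap_history n k : bounded_measurable (gap n k : H n -> R).
Proof.
apply: bounded_measurableM; first exact: avail_history.
apply: bounded_measurableB; first exact: alloc_history.
exact: bounded_measurable_cst.
Qed.

Lemma bounded_measurable_energy n : bounded_measurable (energy n).
Proof.
apply: bounded_measurable_sum => k.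
apply: bounded_measurableM; first exact: bounded_measurable_cst.
under eq_fun do rewrite expr2.
by apply: bounded_measurableM; exact: bounded_measurable_history (gap_history n k).
Qed.

Lemma bounded_measurable_distance n : bounded_measurable (distance n).
Proof.
apply: bounded_measurable_sum => k; under eq_fun do rewrite expr2.
have b : bounded_measurable (fun w => p n k w - target k).
  apply: bounded_measurableB; last exact: bounded_measurable_cst.
  exact: bounded_measurable_history (alloc_history k (leqnn n)).
exact: (bounded_measurableM b b).
Qed.

(** Projecting does not increase the distance to [target], a point of the constraint set. In the
    expanded square each quadratic term is at most [beta n ^+ 2], as the update directions have
    absolute value at most 1. *)
Lemma distance_step n w :
  distance n.+1 w <= distance n w +
    2 * beta n * \sum_k gap n k w * net_arrival n k w + beta n ^+ 2 * K%:R.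
Proof.
have [_] := euclid_proj_contracts
  (fun k => p n k w + beta n * policy_update hpath Q n k w)
  (allocations_target lam_capacity eps0_le).
rewrite -p_step => h; apply: (le_trans h).
have -> : K%:R = \sum_(k < K) 1 :> R by rewrite sumr_const card_ord.
rewrite !mulr_sumr -!big_split/=.
apply: ler_sum => k _; rewrite policy_updateE -/(nu k) -/(target k).
have : (avail n k w * net_arrival n k w) ^+ 2 <= 1.
  rewrite /avail /net_arrival.
  by case: available; case: (a _ _ _); case: completed; rewrite /=; lra.
have := sqr_ge0 (beta n); move: (beta n ^+ 2) (expr2 (beta n)) => b2 b2E b20 h1.
have : b2 * (avail n k w * net_arrival n k w) ^+ 2 <= b2 by rewrite ler_piMr.
have -> : (p n k w + beta n * (avail n k w * net_arrival n k w) - target k) ^+ 2 =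
   (p n k w - target k) ^+ 2 + 2 * beta n * (gap n k w * net_arrival n k w) +
   b2 * (avail n k w * net_arrival n k w) ^+ 2 by rewrite b2E /gap; ring.
by rewrite mulr1; lra.
Qed.

Lemma mean_distance_step n :
  2 * beta n * mean P (energy n) <=
  mean P (distance n) - mean P (distance n.+1) + beta n ^+ 2 * K%:R.
Proof.
have bg k := bounded_measurable_history (gap_history n k).
have bn k := bounded_measurable_history (net_arrival_history k (ltnSn n)).
have bgn k := bounded_measurableM (bg k) (bn k).
have bS := bounded_measurable_sum (index_enum 'I_K) xpredT bgn.
have bc (c : R) := bounded_measurable_cst (T := T) c.
have b1 := bounded_measurableD (bounded_measurable_distance n)
  (bounded_measurableM (bc (2 * beta n)) bS).
have b2 := bounded_measurableD b1 (bc (beta n ^+ 2 * K%:R)).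
have := mean_le P (bounded_measurable_distance n.+1) b2 (distance_step n).
rewrite (meanD P b1 (bc _)) mean_cst.
rewrite (meanD P (bounded_measurable_distance n) (bounded_measurableM (bc _) bS)).
rewrite (meanZ P _ bS) mean_sum//.
have -> : \sum_k mean P (fun w => gap n k w * net_arrival n k w) =
    - mean P (energy n).
  have bgg k : bounded_measurable (fun w => mu N k * gap n k w ^+ 2).
    apply: bounded_measurableM; first exact: bc.
    by under eq_fun do rewrite expr2; exact: bounded_measurableM.
  rewrite [mean P (energy n)]mean_sum// -sumrN; apply: eq_bigr => k _.
  rewrite (mean_net_arrival k (gap_history n k)).
  rewrite -[RHS]mulN1r -(meanZ P _ (bgg k)); congr mean; apply/funext => w.
  rewrite /drift -mu_target /gap /avail.
  by case: available; rewrite /=; ring.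
lra.
Qed.

(** A convergent sequence is bounded. This allows the weights [beta n] to be traded for the weights
    [1 / n.+1] of Kronecker's lemma. *)
Lemma inv_le_beta : exists2 B : R, 0 <= B & forall n, n.+1%:R^-1 <= B * beta n.
Proof.
have /cvg_seq_bounded[B [_ BP]] := beta_lim.
have {}BP n : (n%:R * beta n)^-1 <= `|B| + 1.
  rewrite (le_trans (ler_norm _))// BP//.
  by rewrite (le_lt_trans (ler_norm _))// ltrDl.
exists (`|B| + 1) => [|n]; first by rewrite addr_ge0.
have h n' : (0 < n')%N -> n'%:R^-1 <= (`|B| + 1) * beta n'.
  move=> n0; have := BP n'; rewrite invfM -ler_pdivlMr ?invr_gt0// invrK.
  by [].
(* At index 0 the quotient has denominator 0 and says nothing about [beta 0]; index 1 and
   [beta 1 <= beta 0] are used instead. *)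
case: n => [|n].
  rewrite (le_trans (h 1%N isT))// ler_wpM2l ?addr_ge0//.
  exact: beta_decr.
rewrite (le_trans _ (h n.+1 isT))// lef_pV2 ?posrE ?ltr0n//.
by rewrite ler_nat.
Qed.

(** Summing [mean_distance_step] telescopes the distances, so the mean energies weighted by [beta]
    have bounded sums. By [inv_le_beta] so do those weighted by [1 / n.+1]; the weighted series thus
    converges almost surely, and Kronecker's lemma removes the weights. *)
Lemma ae_energy_sublinear :
  {ae P, forall w, sublinear (series (energy ^~ w))}.
Proof.
have [B B0 BP] := inv_le_beta.
have energy_ge0 n w : 0 <= energy n w.
  by apply: sumr_ge0 => k _; rewrite mulr_ge0 ?sqr_ge0// ltW// mu_gt0.
have mean_energy_ge0 n : 0 <= mean P (energy n) by exact: mean_ge0.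
have partial n : \sum_(0 <= i < n) 2 * beta i * mean P (energy i) <=
    mean P (distance 0%N) + limn (series (fun n => beta n ^+ 2)) * K%:R.
  apply: (@le_trans _ _ (mean P (distance 0%N) - mean P (distance n) +
      series (fun n => beta n ^+ 2) n * K%:R)).
    elim: n => [|n IH]; first by rewrite /series/= !big_nil subrr mul0r addr0.
    rewrite big_nat_recr//= seriesSr mulrDl.
    by have := mean_distance_step n; lra.
  rewrite lerD//.
    by rewrite lerBlDr lerDl mean_ge0// => w; apply: sumr_ge0 => k _; exact: sqr_ge0.
  rewrite ler_wpM2r//; apply: nondecreasing_cvgn_le => //.
  by apply: nondecreasing_series => i _ _; exact: sqr_ge0.
have bf n : bounded_measurable (fun w => energy n w / n.+1%:R).
  apply: bounded_measurableM; last exact: bounded_measurable_cst.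
  exact: bounded_measurable_energy.
have f0 n w : 0 <= energy n w / n.+1%:R by rewrite divr_ge0.
have fB n : \sum_(0 <= i < n) mean P (fun w => energy i w / i.+1%:R) <=
    B * (mean P (distance 0%N) + limn (series (fun n => beta n ^+ 2)) * K%:R).
  apply: le_trans (ler_wpM2l B0 (partial n)).
  rewrite mulr_sumr; apply: ler_sum => i _.
  rewrite (_ : (fun w => _) = (fun w => i.+1%:R^-1 * energy i w)); last first.
    by apply/funext => w; rewrite mulrC.
  rewrite (meanZ P _ (bounded_measurable_energy i)) mulrA.
  rewrite ler_wpM2r// (le_trans (BP i))// ler_wpM2l//.
  by have := beta_gt0 i; lra.
apply: filterS (ae_cvg_series bf f0 fB) => w.
exact: sublinear_kronecker.
Qed.

(** Each [mu * gap ^+ 2] is one of the nonnegative terms of [energy]; [sublinear_series_norm] then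
    passes from squares to absolute values. *)
Lemma ae_gap_sublinear :
  {ae P, forall w k, sublinear (series (fun n => gap n k w))}.
Proof.
apply: filterS ae_energy_sublinear => w energy_sub k.
apply: (@sublinear_le _ _ (series (fun n => `|gap n k w|)) 0) => [n|].
  rewrite addr0 [leRHS]ger0_norm; first exact: ler_norm_sum.
  by rewrite /series/= sumr_ge0.
apply: sublinear_series_norm.
have := sublinearZ (mu N k)^-1 energy_sub.
apply: (@sublinear_le _ _ _ 0) => n; rewrite addr0.
have muk := mu_gt0 N k.
have leg : series (fun n => gap n k w ^+ 2) n <=
    (mu N k)^-1 * series (energy ^~ w) n.
  rewrite /series/= mulr_sumr; apply: ler_sum => i _.
  rewrite mulrC ler_pdivlMr// mulrC /energy (bigD1 k)//= lerDl.
  by apply: sumr_ge0 => j _; rewrite mulr_ge0 ?sqr_ge0// ltW// mu_gt0.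
rewrite ger0_norm; first exact: le_trans leg (ler_norm _).
by apply: sumr_ge0 => i _; exact: sqr_ge0.
Qed.

(** * Sublinear backlogs and rate stability *)

(** The splitting [net_arrival = noise + nu * (1 - avail) - mu * gap], with sublinear sums of
    [noise] and [gap], is the drift condition of [sublinear_workload]. *)
Lemma ae_backlog_sublinear :
  {ae P, forall w k, sublinear (fun n => backlog n k w)}.
Proof.
have noise_sub : {ae P, forall w k, sublinear (series (fun n => noise n k w))}.
  exact: filter_forall ae_noise_sublinear.
apply: filterS2 noise_sub ae_gap_sublinear => w ns gs.
apply: (@sublinear_workload _ _ _ _ N nu (fun n k => backlog n k w)
  (fun n q => Q n q w)) => [k|n q|k].
- by rewrite ltW//; have /andP[] := lam01 (cls N k).
- exact: queue_backlog.
have := sublinearD (ns k) (sublinearZ (- mu N k) (gs k)).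
apply: (@sublinear_le _ _ _ 0) => n; rewrite addr0 le_eqVlt; apply/orP; left.
apply/eqP; congr `|_|; rewrite /backlog /series/= !mulr_sumr -sumrN -!big_split/=.
apply: eq_bigr => i _; rewrite /noise /drift /gap -mu_target /avail.
by case: available; rewrite /=; ring.
Qed.

Lemma ae_queue_rate_stable q :
  {ae P, forall w, (fun n : nat => (Q n q w)%:R / n%:R : R) @ \oo --> (0 : R)}.
Proof.
apply: filterS ae_backlog_sublinear => w bs; apply: sublinear_cvg.
have src_sub : sublinear (fun n => src_val (backlog n ^~ w) q).
  by rewrite /src_val; case: src => [k'|]; [exact: bs|exact: sublinear0].
have := sublinearD (bs (tgt q)) (sublinearZ (-1) src_sub).
apply: (@sublinear_le _ _ _ (Q 0 q w)%:R) => n.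
rewrite (queue_backlog n) -addrA mulN1r (le_trans (ler_normD _ _))// [leLHS]addrC lerD2l.
by rewrite normr_nat.
Qed.

End Policy.

Theorem theorem2 (R : realType) (M K J : nat) (N : network R M K J)
    (lam : 'I_M -> R) (eps0 : R) (beta : nat -> R)
    (hpath : 'I_K -> seq 'I_K) (Q0 : queue N -> nat) (p0 : 'I_K -> R)
    (d : measure_display) (T : measurableType d) (P : probability T R)
    (a : nat -> 'I_M -> {RV P >-> bool}) (s : nat -> 'I_K -> {RV P >-> bool})
    (Q : nat -> queue N -> {RV P >-> nat}) (p : nat -> 'I_K -> {RV P >-> R})
    (lam01 : forall m, 0 < lam m < 1)
    (lam_capacity : capacity_region N lam)
    (eps0_gt0 : 0 < eps0)
    (eps0_le : forall k, eps0 <= lam (cls N k) / mu N k)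
    (beta_gt0 : forall n, 0 < beta n)
    (beta_decr : nonincreasing_seq beta)
    (beta_sum : series beta @ \oo --> +oo)
    (beta_sqr_sum : cvgn (series (fun n => beta n ^+ 2)))
    (beta_lim : cvgn (fun n : nat => (n%:R * beta n)^-1))
    (hpath_path : forall k, root_path N k (hpath k))
    (p0_alloc : allocations N p0)
    (Q_init : forall q w, Q 0%N q w = Q0 q)
    (p_init : forall k w, p 0%N k w = p0 k)
    (Q_step : forall n q w,
      (Q n.+1 q w + completed s Q n (tgt q) w = Q n q w + inflow a s Q n q w)%N)
    (p_step : forall n w,
      (fun k => p n.+1 k w) =
      euclid_proj (allocations_ge N eps0)
        (fun k => p n k w + beta n * policy_update hpath Q n k w))
    (cond_law : forall n,
      cond_indep_bernoulli P (history Q p n)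
        (fun i : 'I_M + 'I_K =>
           match i with inl m => a n m : T -> bool | inr k => s n k end)
        (fun i w =>
           match i with inl m => lam m | inr k => mu N k * p n k w end)) :
  forall q : queue N,
    {ae P, forall w, (fun n : nat => (Q n q w)%:R / n%:R : R) @ \oo --> (0 : R)}.
Proof.
move=> q.
apply: (@ae_queue_rate_stable R M K J N d T P lam eps0 beta hpath
  (fun n m => a n m) (fun n k => s n k) (fun n q => Q n q) (fun n k => p n k)
  lam01 lam_capacity eps0_le beta_gt0 beta_decr beta_sqr_sum beta_lim
  hpath_path) => //.
move=> w; have p0E : (fun k => p 0%N k w) = p0.
  by apply/funext => k; exact: p_init.
by move: p0_alloc; rewrite -p0E.
Qed.
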